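(* Let $M$ be an sRC-manifold, let $K$ be a weak $H$-Killing field on $M$, and let $X,Y,Z$ be horizontal vector fields. Then $$\mathrm{Rm}^s(X,K,Y,Z)=\langle\nabla\mathcal{B}_K(Y,X),Z\rangle+\tfrac12\mathcal{B}_K(\mathrm{Tor}(X,Y),Z)-\tfrac12\mathcal{B}_K(\mathrm{Tor}(X,Z),Y)-\tfrac12\mathcal{B}_K(\mathrm{Tor}(Y,Z),X).$$ If $K$ is an $H$-Killing field, then $R(X,K)Y=\nabla\mathcal{B}_K(Y,X)$.
   Context: A sub-Riemannian manifold is a smooth manifold $M$ with a smooth bracket-generating subbundle $HM\subseteq TM$ and a smooth inner product $\langle\cdot,\cdot\rangle$ on $HM$. An sRC-manifold is a sub-Riemannian manifold together with a smooth subbundle $VM$ such that $TM=HM\oplus VM$. Subscripts $H$, $V$ denote the projections; horizontal means a section of $HM$. A smooth vector field $K$ is a weak $H$-Killing field if $[K,HM]\subset HM$ (brackets with sections) and $K\langle X,Y\rangle=\langle[K,X],Y\rangle+\langle X,[K,Y]\rangle$ for all sections $X,Y$ of $HM$. It is an $H$-Killing field if in addition $[K,VM]\subset VM$. Fix a Riemannian metric $g$ (also written $\langle\cdot,\cdot\rangle$) extending $\langle\cdot,\cdot\rangle$ with $HM\perp VM$. The canonical connection $\nabla$ is the unique connection that is compatible with $g$, makes $HM$ and $VM$ parallel, and whose torsion $\mathrm{Tor}(A,B)=\nabla_AB-\nabla_BA-[A,B]$ satisfies $\mathrm{Tor}(HM,HM)\subseteq VM$, $\mathrm{Tor}(VM,VM)\subseteq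 HM$, and $g(\mathrm{Tor}(Z,X),Y)=g(\mathrm{Tor}(Z,Y),X)$ whenever $X,Y$ lie in one of $HM,VM$ and $Z$ lies in the other. $\mathcal{B}_K:TM\to HM$ is the tensor $\mathcal{B}_K(A)=\nabla_AK_H+\mathrm{Tor}(K,A)_H=(\nabla_KA-[K,A])_H$; as a bilinear form $\mathcal{B}_K(A,B)=\langle\mathcal{B}_K(A),B\rangle$. Its covariant derivative is $\nabla\mathcal{B}_K(Y,X)=(\nabla_X\mathcal{B}_K)(Y)=\nabla_X(\mathcal{B}_K(Y))-\mathcal{B}_K(\nabla_XY)$. Curvature: $R(A,B)C=(\nabla_A\nabla_B-\nabla_B\nabla_A-\nabla_{[A,B]})C$ and $\mathrm{Rm}^s(A,B,C,D)=\langle R(A,B)C,D\rangle$. *)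

(* Defs.v *)
From HB Require Import structures.
From mathcomp Require Import all_boot all_order all_algebra.
From mathcomp Require Import all_classical all_reals all_analysis.

Set Implicit Arguments.
Unset Strict Implicit.
Unset Printing Implicit Defensive.

Import Order.TTheory GRing.Theory Num.Theory numFieldNormedType.Exports.

Local Open Scope classical_set_scope.
Local Open Scope ring_scope.

(* All iterated partial derivatives of f of order at most k exist and are
   continuous on U. Only meaningful for U open. *)

Fixpoint Ck (R : realType) (n k : nat) (U : set 'rV[R]_n) (f : 'rV[R]_n -> R) :
    Prop :=
  (forall x, U x -> {for x, continuous f}) /\
  match k with
  | 0 => True
  | k'.+1 => forall i : 'I_n,
      (forall x, U x -> derivable f x (delta_mx 0 i)) /\
      Ck k' U (fun x => 'D_(delta_mx 0 i) f x)
  end.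

Definition smooth_on (R : realType) (n : nat) (U : set 'rV[R]_n)
    (f : 'rV[R]_n -> R) : Prop :=
  forall k, Ck k U f.

Section ck_theory.
Variables (R : realType) (n : nat) (U : set 'rV[R]_n).
Hypothesis openU : open U.
Implicit Types f g : 'rV[R]_n -> R.

Lemma Ck_continuous k f x : Ck k U f -> U x -> {for x, continuous f}.
Proof. by case: k => [|k] [cf _] /cf. Qed.

Lemma Ck_ext k f g : (forall x, U x -> f x = g x) -> Ck k U f -> Ck k U g.
Proof.
have nearU (f' g' : 'rV[R]_n -> R) x : (forall y, U y -> f' y = g' y) -> U x ->
    \forall y \near x, f' y = g' y.
  move=> fg Ux; have : nbhs x U by exact: open_nbhs_nbhs.
  by apply: filterS => y /fg.
have Ccont (f' g' : 'rV[R]_n -> R) : (forall x, U x -> f' x = g' x) ->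
    (forall x, U x -> {for x, continuous f'}) ->
    forall x, U x -> {for x, continuous g'}.
  move=> fg cf x Ux; rewrite /prop_for /continuous_at -(fg _ Ux).
  by apply: cvg_trans (cf x Ux); exact: near_eq_cvg (nearU _ _ _ fg Ux).
elim: k f g => [|k IH] f g fg [cf df]; split=> //; try exact: Ccont cf.
move=> i; have [dfi Cfi] := df i; split.
  by move=> x Ux; apply: near_eq_derivable (dfi x Ux); exact: nearU.
by apply: IH Cfi => x Ux; apply: near_eq_derive; exact: nearU.
Qed.

Lemma CkW k f : Ck k.+1 U f -> Ck k U f.
Proof.
elim: k f => [|k IH] f [cf df]; split=> // i.
by have [dfi Cfi] := df i; split=> //; exact: IH.
Qed.

Lemma Ck_cst k (c : R) : Ck k U (cst c).
Proof.
have cc (a : R) (x : 'rV[R]_n) : {for x, continuous (cst a)}.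
  exact: cst_continuous.
elim: k c => [|k IH] c; split=> //.
move=> i; split=> [x _|]; first exact: derivable_cst.
by apply: Ck_ext (IH 0) => x _; rewrite derive_cst.
Qed.

Lemma CkD k f g : Ck k U f -> Ck k U g -> Ck k U (f + g).
Proof.
elim: k f g => [|k IH] f g Cf Cg;
  (split; first by move=> x Ux; apply: continuousD;
    [exact: Ck_continuous Cf Ux|exact: Ck_continuous Cg Ux]) => //.
move=> i; have [dfi Cfi] := Cf.2 i; have [dgi Cgi] := Cg.2 i; split.
  by move=> x Ux; apply: derivableD; [exact: dfi|exact: dgi].
apply: Ck_ext (IH _ _ Cfi Cgi) => x Ux.
by rewrite deriveD //; [exact: dfi|exact: dgi].
Qed.

Lemma CkM k f g : Ck k U f -> Ck k U g -> Ck k U (f * g).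
Proof.
elim: k f g => [|k IH] f g Cf Cg;
  (split; first by move=> x Ux; apply: continuousM;
    [exact: Ck_continuous Cf Ux|exact: Ck_continuous Cg Ux]) => //.
move=> i; have [dfi Cfi] := Cf.2 i; have [dgi Cgi] := Cg.2 i; split.
  by move=> x Ux; apply: derivableM; [exact: dfi|exact: dgi].
apply: Ck_ext (CkD (IH _ _ (CkW Cf) Cgi) (IH _ _ (CkW Cg) Cfi)) => x Ux.
by rewrite deriveM //; [exact: dfi|exact: dgi].
Qed.

End ck_theory.

(* A chart is a homeomorphism [phi] from an open set [dom] onto an open set
   of R^n, with inverse [psi]; the values of [phi] outside [dom], and of
   [psi] outside [phi @` dom], are irrelevant. *)

Record chart (R : realType) (n : nat) (T : topologicalType) := Chart {
  dom : set T;
  phi : T -> 'rV[R]_n;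
  psi : 'rV[R]_n -> T;
  open_dom : open dom;
  open_codom : open (phi @` dom);
  phi_continuous : forall x, dom x -> {for x, continuous phi};
  psi_continuous : forall y, (phi @` dom) y -> {for y, continuous psi};
  phiK : forall x, dom x -> psi (phi x) = x
}.

Arguments open_dom {R n T} c.
Arguments open_codom {R n T} c.

Record manifold (R : realType) (n : nat) := Manifold {
  carrier :> topologicalType;
  hausdorffM : hausdorff_space carrier;
  second_countableM : @second_countable carrier;
  atlas : set (chart R n carrier);
  atlas_cover : forall x, exists2 c, atlas c & dom c x;
  atlas_smooth : forall c d, atlas c -> atlas d -> forall i : 'I_n,
    smooth_on (phi c @` (dom c `&` dom d)) (fun y => phi d (psi c y) 0 i)
}.

Definition smooth (R : realType) (n : nat) (M : manifold R n) (f : M -> R) :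
    Prop :=
  forall c, atlas c -> smooth_on (phi c @` dom c) (f \o psi c).

Definition smooth_pred (R : realType) (n : nat) (M : manifold R n) :
  {pred M -> R} := fun f => `[< smooth f >].

Record cinf (R : realType) (n : nat) (M : manifold R n) := Cinf {
  cinf_fun :> M -> R;
  _ : smooth_pred cinf_fun
}.

HB.instance Definition _ R n (M : manifold R n) :=
  [isSub for @cinf_fun R n M].
HB.instance Definition _ R n (M : manifold R n) := [Choice of cinf M by <:].

Lemma smooth_cst R n (M : manifold R n) (a : R) : smooth (cst a : M -> R).
Proof. by move=> c cA k; exact: (Ck_cst (open_codom c)). Qed.
Arguments smooth_cst {R n} M a.

Lemma cinf_subring R n (M : manifold R n) :
  subring_closed (@smooth_pred R n M).
Proof.
have sM (f g : M -> R) : smooth f -> smooth g -> smooth (f * g).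
  move=> sf sg c cA k.
  exact: (CkM (open_codom c) (sf c cA k) (sg c cA k)).
have sD (f g : M -> R) : smooth f -> smooth g -> smooth (f + g).
  move=> sf sg c cA k.
  exact: (CkD (open_codom c) (sf c cA k) (sg c cA k)).
split=> [|f g /asboolP sf /asboolP sg|f g /asboolP sf /asboolP sg];
  apply/asboolP; first exact: (smooth_cst M 1).
  rewrite -mulN1r; apply: sD => //; apply: sM => //.
  exact: (smooth_cst M (-1)).
exact: sM.
Qed.

HB.instance Definition _ R n (M : manifold R n) :=
  GRing.isSubringClosed.Build (M -> R) (@smooth_pred R n M)
    (@cinf_subring R n M).
HB.instance Definition _ R n (M : manifold R n) :=
  GRing.SubChoice_isSubComPzRing.Build _ _ (cinf M) (GRing.subringClosedP _).

Definition cinf_cst R n (M : manifold R n) (a : R) : cinf M :=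
  Cinf (asboolT (smooth_cst M a)).
Arguments cinf_cst {R n} M a.

(* Tangent vectors at p are R-linear derivations at p of the ring of smooth
   functions. *)

Definition is_derivation_at R n (M : manifold R n) (p : M)
    (v : cinf M -> R^o) : Prop :=
  (forall a f g, v (cinf_cst M a * f + g) = a * v f + v g) /\
  (forall f g, v (f * g) = f p * v g + g p * v f).

Definition tangent_pred R n (M : manifold R n) (p : M) :
  {pred cinf M -> R^o} := fun v => `[< is_derivation_at p v >].

Record tangent R n (M : manifold R n) (p : M) := Tangent {
  tangent_fun :> cinf M -> R^o;
  _ : tangent_pred p tangent_fun
}.

HB.instance Definition _ R n (M : manifold R n) (p : M) :=
  [isSub for @tangent_fun R n M p].
HB.instance Definition _ R n (M : manifold R n) (p : M) :=
  [Choice of tangent p by <:].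

Lemma tangent_submod R n (M : manifold R n) (p : M) :
  submod_closed (tangent_pred p).
Proof.
split=> [|a u v /asboolP[uD uL] /asboolP[vD vL]]; apply/asboolP.
  by split=> [a f g|f g]; rewrite !mulr0 addr0.
have E w : (a *: u + v) w = a * u w + v w by [].
split=> [b f g|f g].
  by rewrite !E uD vD !mulrDr (mulrCA a) addrACA.
by rewrite !E uL vL !mulrDr !(mulrCA a) addrACA.
Qed.

HB.instance Definition _ R n (M : manifold R n) (p : M) :=
  GRing.isSubmodClosed.Build R (cinf M -> R^o) (tangent_pred p)
    (@tangent_submod R n M p).
HB.instance Definition _ R n (M : manifold R n) (p : M) :=
  [SubChoice_isSubLmodule of tangent p by <:].

(* Smooth vector fields, as R-linear derivations of the ring of smooth
   functions; they form a module over that ring. *)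

Definition is_derivation R n (M : manifold R n)
    (D : cinf M -> (cinf M)^o) : Prop :=
  (forall a f g, D (cinf_cst M a * f + g) = cinf_cst M a * D f + D g) /\
  (forall f g, D (f * g) = f * D g + g * D f).

Definition vfield_pred R n (M : manifold R n) :
  {pred cinf M -> (cinf M)^o} := fun D => `[< is_derivation D >].

Record vfield R n (M : manifold R n) := VField {
  vfield_fun :> cinf M -> (cinf M)^o;
  _ : vfield_pred vfield_fun
}.

HB.instance Definition _ R n (M : manifold R n) :=
  [isSub for @vfield_fun R n M].
HB.instance Definition _ R n (M : manifold R n) := [Choice of vfield M by <:].

Lemma vfield_submod R n (M : manifold R n) :
  submod_closed (@vfield_pred R n M).
Proof.
split=> [|a u v /asboolP[uD uL] /asboolP[vD vL]]; apply/asboolP.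
  by split=> [a f g|f g]; rewrite !mulr0 addr0.
have E w : (a *: u + v) w = a * u w + v w by [].
split=> [b f g|f g].
  by rewrite !E uD vD !mulrDr (mulrCA a) addrACA.
by rewrite !E uL vL !mulrDr !(mulrCA a) addrACA.
Qed.

HB.instance Definition _ R n (M : manifold R n) :=
  GRing.isSubmodClosed.Build (cinf M) (cinf M -> (cinf M)^o)
    (@vfield_pred R n M)
    (@vfield_submod R n M).
HB.instance Definition _ R n (M : manifold R n) :=
  [SubChoice_isSubLmodule of vfield M by <:].

Lemma value_subproof R n (M : manifold R n) (X : vfield M) (p : M) :
  tangent_pred p (fun f => (X f : cinf M) p).
Proof.
have /asboolP[XD XL] := valP X.
by apply/asboolP; split=> [a f g|f g]; rewrite ?XD ?XL.
Qed.

Definition value R n (M : manifold R n) (X : vfield M) (p : M) : tangent p :=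
  Tangent (value_subproof X p).

Lemma bracket_subproof R n (M : manifold R n) (X Y : vfield M) :
  vfield_pred (fun f => X (Y f) - Y (X f)).
Proof.
have /asboolP[XD XL] := valP X; have /asboolP[YD YL] := valP Y.
have XA f g : X (f + g) = X f + X g.
  have := XD 1 f g; rewrite (_ : cinf_cst M 1 = 1) ?mul1r //.
  exact: val_inj.
have YA f g : Y (f + g) = Y f + Y g.
  have := YD 1 f g; rewrite (_ : cinf_cst M 1 = 1) ?mul1r //.
  exact: val_inj.
have E (V : zmodType) (a b c d e f : V) :
    a + b + (c + d) - (e + d + (f + b)) = a - e + (c - f).
  rewrite (addrACA a) (addrACA e) (addrC d) opprD [LHS]addrACA subrr addr0.
  by rewrite opprD addrACA.
apply/asboolP; split=> [a f g|f g].
  by rewrite XD YD XD YD mulrBr opprD addrACA.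
rewrite XL YL XA YA !XL !YL (mulrC (Y g)) (mulrC (Y f)) !mulrBr.
exact: E.
Qed.

Definition bracket R n (M : manifold R n) (X Y : vfield M) : vfield M :=
  VField (bracket_subproof X Y).

(* A family of subspaces of the tangent spaces. It is a smooth subbundle when,
   near every point, it has a frame of smooth vector fields. The frame may be
   taken to consist of global vector fields, since a local frame extends after
   multiplication by a cut-off function and shrinking the neighbourhood. The
   rank is only required to be locally constant. *)

Definition distribution R n (M : manifold R n) :=
  forall p : M, set (tangent p).

Definition is_basis R n (M : manifold R n) (p : M) (k : nat)
    (e : 'I_k -> tangent p) (S : set (tangent p)) : Prop :=
  (forall a : 'I_k -> R, \sum_(i < k) a i *: e i = 0 -> forall i, a i = 0) /\
  S = [set v | exists a : 'I_k -> R, v = \sum_(i < k) a i *: e i].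

Definition is_subbundle R n (M : manifold R n) (D : distribution M) : Prop :=
  forall p : M, exists (k : nat) (E : 'I_k -> vfield M),
    \forall q \near p, is_basis (fun i => value (E i) q) (D q).

Definition full_distribution R n (M : manifold R n) : distribution M :=
  fun p => [set: tangent p].

Definition is_section R n (M : manifold R n) (D : distribution M)
    (X : vfield M) : Prop :=
  forall p, D p (value X p).

Definition is_direct_sum R n (M : manifold R n) (D E : distribution M) : Prop :=
  forall p : M,
    (forall v, exists2 d, D p d & E p (v - d)) /\
    (forall v, D p v -> E p v -> v = 0).

Inductive lie_generated R n (M : manifold R n) (D : distribution M) :
    vfield M -> Prop :=
  | lie_section X : is_section D X -> lie_generated D X
  | lie_add X Y :
      lie_generated D X -> lie_generated D Y -> lie_generated D (X + Y)
  | lie_scale a X : lie_generated D X -> lie_generated D (cinf_cst M a *: X)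
  | lie_bracket X Y :
      lie_generated D X -> lie_generated D Y -> lie_generated D (bracket X Y).

Definition bracket_generating R n (M : manifold R n) (D : distribution M) :
    Prop :=
  forall (p : M) (v : tangent p), exists2 X, lie_generated D X & value X p = v.

(* A smooth inner product on the subbundle D; the values of [metric_fun]
   outside D are irrelevant. *)

Record metric R n (M : manifold R n) (D : distribution M) := Metric {
  metric_fun :> forall p : M, tangent p -> tangent p -> R;
  metric_sym : forall p u v, D p u -> D p v ->
    metric_fun u v = metric_fun v u;
  metric_linear : forall p (a : R) u v w, D p u -> D p v -> D p w ->
    metric_fun (a *: u + v) w = a * metric_fun u w + metric_fun v w;
  metric_pos : forall p u, D p u -> u != 0 -> 0 < metric_fun u u;
  metric_smooth : forall X Y, is_section D X -> is_section D Y ->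
    smooth (fun p => metric_fun (value X p) (value Y p))
}.

Notation riemannian_metric M := (metric (@full_distribution _ _ M)).

(* The default value 0 is taken only when p |-> <X_p, Y_p> is not smooth, which
   by [metric_smooth] does not occur for X and Y sections of D. *)
Definition inner R n (M : manifold R n) (D : distribution M) (m : metric D)
    (X Y : vfield M) : cinf M :=
  insubd 0 (fun p => m p (value X p) (value Y p)).

Record subriemannian R n (M : manifold R n) := SubRiemannian {
  horiz : distribution M;
  horiz_subbundle : is_subbundle horiz;
  horiz_generating : bracket_generating horiz;
  horiz_metric : metric horiz
}.

Record src_structure R n (M : manifold R n) := SrcStructure {
  src_sub :> subriemannian M;
  vert : distribution M;
  vert_subbundle : is_subbundle vert;
  horiz_vert : is_direct_sum (horiz src_sub) vert
}.

Section src.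
Variables (R : realType) (n : nat) (M : manifold R n) (S : src_structure M).

Definition horizontal (X : vfield M) : Prop := is_section (horiz S) X.
Definition vertical (X : vfield M) : Prop := is_section (vert S) X.

Definition weak_H_killing (K : vfield M) : Prop :=
  (forall X, horizontal X -> horizontal (bracket K X)) /\
  (forall X Y, horizontal X -> horizontal Y ->
    K (inner (horiz_metric S) X Y) =
      inner (horiz_metric S) (bracket K X) Y +
      inner (horiz_metric S) X (bracket K Y)).

Definition H_killing (K : vfield M) : Prop :=
  weak_H_killing K /\ (forall X, vertical X -> vertical (bracket K X)).

(* The component A_H of A along TM = HM (+) VM. The decomposition exists and
   is unique because HM and VM are complementary smooth subbundles, so the
   default 0 is never taken. *)
Definition proj_H (A : vfield M) : vfield M :=
  xget 0 [set B | horizontal B /\ vertical (A - B)].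

Definition extends_orthogonally (g : riemannian_metric M) : Prop :=
  (forall p u v, horiz S u -> horiz S v -> g p u v = horiz_metric S p u v) /\
  (forall p u v, horiz S u -> vert S v -> g p u v = 0).

End src.

Record connection R n (M : manifold R n) := Connection {
  nabla :> vfield M -> vfield M -> vfield M;
  connection_linear : forall (f : cinf M) A B C,
    nabla (f *: A + B) C = f *: nabla A C + nabla B C;
  connection_add : forall A B C, nabla A (B + C) = nabla A B + nabla A C;
  connection_leibniz : forall A (f : cinf M) B,
    nabla A (f *: B) = (A f : cinf M) *: B + f *: nabla A B
}.

Definition torsion R n (M : manifold R n) (nab : connection M)
    (A B : vfield M) : vfield M :=
  nab A B - nab B A - bracket A B.

Definition curvature R n (M : manifold R n) (nab : connection M)
    (A B C : vfield M) : vfield M :=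
  nab A (nab B C) - nab B (nab A C) - nab (bracket A B) C.

Section canonical.
Variables (R : realType) (n : nat) (M : manifold R n) (S : src_structure M).
Variables (g : riemannian_metric M) (nab : connection M).

Local Notation "<| X , Y |>" := (inner g X Y) (at level 0).
Local Notation Tor := (torsion nab).
Local Notation horizontal := (horizontal S).
Local Notation vertical := (vertical S).

Record is_canonical_connection : Prop := IsCanonicalConnection {
  canonical_metric : forall A B C : vfield M,
    A <| B, C |> = <| nab A B, C |> + <| B, nab A C |>;
  canonical_horizontal : forall A X, horizontal X -> horizontal (nab A X);
  canonical_vertical : forall A X, vertical X -> vertical (nab A X);
  canonical_torsion_H : forall X Y,
    horizontal X -> horizontal Y -> vertical (Tor X Y);
  canonical_torsion_V : forall X Y,
    vertical X -> vertical Y -> horizontal (Tor X Y);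
  canonical_torsion_sym : forall X Y Z,
    (horizontal X /\ horizontal Y /\ vertical Z) \/
    (vertical X /\ vertical Y /\ horizontal Z) ->
    <| Tor Z X, Y |> = <| Tor Z Y, X |>
}.

Definition calB (K A : vfield M) : vfield M :=
  nab A (proj_H S K) + proj_H S (Tor K A).

Definition calB_form (K A B : vfield M) : cinf M := <| calB K A, B |>.

(* [nabla_calB K Y X] is (nabla_X B_K)(Y). *)
Definition nabla_calB (K Y X : vfield M) : vfield M :=
  nab X (calB K Y) - calB K (nab X Y).

Definition Rm (A B C D : vfield M) : cinf M := <| curvature nab A B C, D |>.

End canonical.

(* Main.v *)
From HB Require Import structures.
From mathcomp Require Import all_boot all_order all_algebra.
From mathcomp Require Import all_classical all_reals all_analysis.
From mathcomp Require Import ring lra.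
Require Import Defs.

(** The curvature formula says how far the flow of [K] is from preserving the
    connection. Write [S := lie_nabla nab K], i.e.
    S(X,Y) = [K, nabla_X Y] - nabla_[K,X] Y - nabla_X [K,Y], for the Lie
    derivative of the connection along [K]. For horizontal Y, both Y and [K,Y]
    are horizontal, so B_K(Y) = nabla_K Y - [K,Y] without any projection;
    expanding the definitions then gives R(X,K)Y = (nabla_X B_K)(Y) - S(X,Y)
    ([curvature_lie_nabla]). It remains to compute <S(X,Y),Z>.

    Two facts about S are available. First, S(X,.) is skew on HM
    ([lie_nabla_skew]), because on functions of the form <Y,Z> the derivations
    K and X are compatible with [K,.] and nabla_X respectively, and their
    commutator is [K,X]. Second, by the Jacobi identity S(X,Y) - S(Y,X) is the
    Lie derivative along K of the torsion; since Tor(HM,HM) is vertical and K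
    preserves HM, its horizontal part is that of [K, Tor(X,Y)], which is
    - B_K(Tor(X,Y)) ([lie_nabla_torsion]). A tensor that is skew in its last
    two slots is determined by its antisymmetrization in the first two: this is
    the linear algebra by which a metric connection is recovered from its
    torsion, and it produces the three terms with coefficient 1/2. If K also
    preserves VM these terms vanish, and R(X,K)Y, (nabla_X B_K)(Y) are two
    horizontal fields with the same horizontal inner products.

    The analytic input is that the horizontal component of a smooth vector
    field is smooth ([proj_H_exists]), so that [proj_H] is a genuine
    projection. In a local horizontal frame the components are obtained from
    inner products by inverting the Gram matrix; by Cramer's rule they are
    locally quotients of globally defined smooth functions, hence smooth
    ([smooth_quotient]). *)

Set Implicit Arguments.
Unset Strict Implicit.
Unset Printing Implicit Defensive.

Import Order.TTheory GRing.Theory Num.Theory numFieldNormedType.Exports.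

Local Open Scope classical_set_scope.
Local Open Scope ring_scope.

(** * Functions of class C^k: locality and inverses *)

Section ck.
Variables (R : realType) (n : nat).
Implicit Types (U V : set 'rV[R]_n) (f : 'rV[R]_n -> R).

Lemma Ck_sub k U V f : V `<=` U -> Ck k U f -> Ck k V f.
Proof.
move=> VU; elim: k f => [|k IH] f [cf df]; split=> //; try by move=> x /VU /cf.
by move=> i; have [dfi Cfi] := df i; split=> [x /VU /dfi|]; last exact: IH.
Qed.

Lemma Ck_local k U f :
  (forall x, U x -> exists2 V, V x & Ck k V f) -> Ck k U f.
Proof.
elim: k f => [|k IH] f Uf; split=> //;
  try by move=> x /Uf[V Vx [cf _]]; exact: cf.
move=> i; split=> [x /Uf[V Vx [_ df]]|]; first exact: (df i).1.
by apply: IH => x /Uf[V Vx [_ df]]; exists V => //; exact: (df i).2.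
Qed.

Lemma CkV k U f : open U -> (forall x, U x -> f x != 0) ->
  Ck k U f -> Ck k U (fun x => (f x)^-1).
Proof.
move=> oU f0; elim: k => [|k IH] Cf;
  (split; first by move=> x Ux; apply: continuousV;
    [exact: f0|exact: Ck_continuous Cf Ux]) => //.
move=> i; have [dfi Cfi] := Cf.2 i; split.
  by move=> x Ux; apply: derivableV; [exact: f0|exact: dfi].
have CV := IH (CkW Cf).
(* The derivative of 1/f is (-1) * (1/f * 1/f) * f', and the induction
   hypothesis makes 1/f of class C^k. *)
have := CkM oU (CkM oU (Ck_cst oU k (-1)) (CkM oU CV CV)) Cfi.
apply: (Ck_ext oU) => x Ux; rewrite deriveV ?f0 //; last exact: dfi.
rewrite /GRing.scale /= [LHS]/(_ * _) /=.
by congr (_ * _); rewrite -exprVn expr2 [LHS]mulN1r.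
Qed.

End ck.

(** * Smooth functions and vector fields *)

Section smooth.
Variables (R : realType) (n : nat) (M : manifold R n).
Implicit Types (f h : cinf M) (X Y Z A B K : vfield M).

(** Smoothness may be tested near each point. Multiplying out the denominator
    in the hypothesis avoids speaking of partially defined smooth functions:
    numerator and denominator are global, only the relation is local. *)
Lemma smooth_quotient (u : M -> R) :
  (forall p : M, exists w d : cinf M,
     \forall q \near p, d q != 0 /\ d q * u q = w q) -> smooth u.
Proof.
move=> Hu c cA k; apply: Ck_local => _ [p pc <-].
have [w [d wd]] := Hu p.
have [/asboolP sw /asboolP sd] := (valP w, valP d).
have oc := open_codom c.
have cp : (phi c @` dom c) (phi c p) by exists p.
pose good y := (phi c @` dom c) y /\
  (d (psi c y) != 0 /\ d (psi c y) * u (psi c y) = w (psi c y)).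
have near_psi : \forall y \near phi c p, good y.
  near=> y; split; first by near: y; exact: open_nbhs_nbhs.
  near: y; have := psi_continuous cp.
  by rewrite /prop_for /continuous_at phiK // => /(_ _ wd).
have [V [oV Vp] VP] : exists2 V, open_nbhs (phi c p) V & V `<=` good.
  by move: near_psi; rewrite -nbhs_nearE nbhsE => -[V]; exists V.
exists V => //.
have VU : V `<=` phi c @` dom c by move=> y /VP[].
have Cd := Ck_sub VU (sd c cA k).
have Cw := Ck_sub VU (sw c cA k).
have dN0 y : V y -> (d \o psi c) y != 0 by move=> /VP[_ []].
apply: (Ck_ext oV) (CkM oV (CkV oV dN0 Cd) Cw) => y /VP[_ [d0 e]].
change ((d (psi c y))^-1 * w (psi c y) = u (psi c y)).
by rewrite -e mulKf.
Unshelve. all: by end_near.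
Qed.

(** Evaluation at a point, named so that it can carry a ring morphism
    structure and commute with determinants and adjugates. *)
Definition cinf_eval (p : M) f : R := f p.

HB.instance Definition _ p := GRing.isZmodMorphism.Build (cinf M) R
  (cinf_eval p) (fun f g => erefl).
HB.instance Definition _ p := GRing.isMonoidMorphism.Build (cinf M) R
  (cinf_eval p) (conj erefl (fun f g => erefl)).

Lemma cinfP f h : (forall p, f p = h p) -> f = h.
Proof. by move=> fh; apply: val_inj; apply/funext. Qed.

Lemma cinfDE f h p : (f + h : cinf M) p = f p + h p.
Proof. by []. Qed.

Lemma cinfNE f p : (- f : cinf M) p = - f p.
Proof. by []. Qed.

Lemma cinf0E p : (0 : cinf M) p = 0.
Proof. by []. Qed.

Lemma tangentP p (u v : tangent p) : (forall f, u f = v f) -> u = v.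
Proof. by move=> uv; apply: val_inj; apply/funext. Qed.

Lemma tangent_sumE p k (a : 'I_k -> R) (e : 'I_k -> tangent p) f :
  (\sum_i a i *: e i) f = \sum_i a i * e i f.
Proof. by elim/big_rec2: _ => // i x y _ <-. Qed.

Lemma vfieldP X Y : (forall p, value X p = value Y p) -> X = Y.
Proof.
move=> XY; apply: val_inj; apply/funext => f; apply: cinfP => p.
exact: (congr1 (fun v : tangent p => v f) (XY p)).
Qed.

Lemma valueD X Y p : value (X + Y) p = value X p + value Y p.
Proof. exact: val_inj. Qed.

Lemma valueB X Y p : value (X - Y) p = value X p - value Y p.
Proof. exact: val_inj. Qed.

Lemma value0 p : value (0 : vfield M) p = 0.
Proof. exact: val_inj. Qed.

Lemma vfieldD X f h : X (f + h) = X f + X h :> cinf M.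
Proof.
have /asboolP[XD _] := valP X.
have := XD 1 f h; rewrite (_ : cinf_cst M 1 = 1) ?mul1r //.
exact: val_inj.
Qed.

Lemma vfieldB X f h : X (f - h) = X f - X h :> cinf M.
Proof. by apply/eqP; rewrite eq_sym subr_eq -vfieldD subrK. Qed.

Lemma vfield_of_values (v : forall p : M, tangent p) :
  (forall f, smooth (fun p => v p f)) ->
  exists B : vfield M, forall p, value B p = v p.
Proof.
move=> sv.
have vD : vfield_pred (fun f => Cinf (asboolT (sv f))).
  apply/asboolP; split=> [a f1 f2|f1 f2]; apply: cinfP => p;
    have /asboolP[vA vL] := valP (v p); first exact: vA.
  exact: vL.
by exists (VField vD) => p; exact: tangentP.
Qed.

(** Reading a vector field through the real numbers (X f)(p) turns additive
    identities between vector fields into ring identities in R. *)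
Definition vfield_eval f (p : M) X : R := (X f : cinf M) p.

Lemma vfield_evalD f p X Y :
  vfield_eval f p (X + Y) = vfield_eval f p X + vfield_eval f p Y.
Proof. by []. Qed.

Lemma vfield_evalN f p X : vfield_eval f p (- X) = - vfield_eval f p X.
Proof. by []. Qed.

Lemma vfield_eval_bracket f p X Y : vfield_eval f p (bracket X Y) =
  vfield_eval (Y f) p X - vfield_eval (X f) p Y.
Proof. by []. Qed.

Lemma vfield_eval_argB f p K X Y : vfield_eval ((X - Y) f) p K =
  vfield_eval (X f) p K - vfield_eval (Y f) p K.
Proof. by rewrite /vfield_eval [(X - Y) f]/(X f - Y f : cinf M) vfieldB. Qed.

Lemma vfield_eval_argbracket f p K X Y : vfield_eval (bracket X Y f) p K =
  vfield_eval (X (Y f)) p K - vfield_eval (Y (X f)) p K.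
Proof.
by rewrite /vfield_eval [bracket X Y f]/(X (Y f) - Y (X f) : cinf M) vfieldB.
Qed.

Lemma vfield_ext X Y :
  (forall f p, vfield_eval f p X = vfield_eval f p Y) -> X = Y.
Proof. by move=> XY; apply: vfieldP => p; apply: tangentP => f; exact: XY. Qed.

Lemma bracketC X Y : bracket X Y = - bracket Y X.
Proof.
by apply: vfield_ext => f p; rewrite vfield_evalN !vfield_eval_bracket opprB.
Qed.

Lemma bracketBr K X Y : bracket K (X - Y) = bracket K X - bracket K Y.
Proof.
apply: vfield_ext => f p.
rewrite !(vfield_evalD, vfield_evalN, vfield_eval_bracket) vfield_eval_argB.
ring.
Qed.

Lemma jacobi K X Y :
  bracket K (bracket X Y) = bracket (bracket K X) Y + bracket X (bracket K Y).
Proof.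
apply: vfield_ext => f p.
rewrite vfield_evalD !vfield_eval_bracket !vfield_eval_argbracket /=.
ring.
Qed.

End smooth.

(** * Sections of subbundles and inner products *)

Section sections.
Variables (R : realType) (n : nat) (M : manifold R n) (D : distribution M).
Hypothesis subD : is_subbundle D.

Lemma subbundle_linear p (a : R) (u v : tangent p) :
  D u -> D v -> D (a *: u + v).
Proof.
have [k [E /nbhs_singleton[_ ->]]] := subD p => -[b ->] [c ->].
exists (fun i => a * b i + c i); rewrite scaler_sumr -big_split /=.
by apply: eq_bigr => i _; rewrite scalerA scalerDl.
Qed.

Lemma sectionD X Y : is_section D X -> is_section D Y -> is_section D (X + Y).
Proof.
move=> hX hY p; rewrite valueD -[value X p]scale1r.
exact: subbundle_linear.
Qed.

Lemma sectionB X Y : is_section D X -> is_section D Y -> is_section D (X - Y).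
Proof.
by move=> hX hY p; rewrite valueB addrC -scaleN1r; exact: subbundle_linear.
Qed.

End sections.

Section riemannian.
Variables (R : realType) (n : nat) (M : manifold R n).
Variable g : riemannian_metric M.
Implicit Types X Y Z : vfield M.

Lemma metricC p (u v : tangent p) : g p u v = g p v u.
Proof. exact: (metric_sym g (u := u) (v := v) I I). Qed.

Lemma metricDl p (u v w : tangent p) : g p (u + v) w = g p u w + g p v w.
Proof.
have := metric_linear g 1 (u := u) (v := v) (w := w) I I I.
by rewrite scale1r mul1r.
Qed.

Lemma metric0l p (w : tangent p) : g p 0 w = 0.
Proof. by apply: (addrI (g p 0 w)); rewrite -metricDl !addr0. Qed.

Lemma metricZl p a (u w : tangent p) : g p (a *: u) w = a * g p u w.
Proof.
have := metric_linear g a (u := u) (v := 0) (w := w) I I I.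
by rewrite metric0l !addr0.
Qed.

Lemma metric_suml p k (a : 'I_k -> R) (e : 'I_k -> tangent p) w :
  g p (\sum_i a i *: e i) w = \sum_i a i * g p (e i) w.
Proof.
elim/big_rec2: _ => [|i x y _ <-]; first exact: metric0l.
by rewrite metricDl metricZl.
Qed.

Lemma metric_eq0 p (u : tangent p) : g p u u = 0 -> u = 0.
Proof.
move=> gu; apply: contrapT => /eqP u0.
by have := metric_pos g (u := u) I u0; rewrite gu ltxx.
Qed.

Lemma inner_section (D : distribution M) (m : metric D) X Y p :
  is_section D X -> is_section D Y ->
  inner m X Y p = m p (value X p) (value Y p).
Proof.
move=> hX hY; rewrite /inner.
have sm := asboolT (metric_smooth m hX hY).
by have /= -> := insubdK 0 (sm : (fun p => _) \in smooth_pred (M := M)).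
Qed.

Lemma innerE X Y p : inner g X Y p = g p (value X p) (value Y p).
Proof. exact: inner_section. Qed.

Lemma innerC X Y : inner g X Y = inner g Y X.
Proof. by apply: cinfP => p; rewrite !innerE metricC. Qed.

Lemma innerDl X Y Z : inner g (X + Y) Z = inner g X Z + inner g Y Z.
Proof. by apply: cinfP => p; rewrite innerE valueD metricDl -!innerE. Qed.

Lemma innerBl X Y Z : inner g (X - Y) Z = inner g X Z - inner g Y Z.
Proof. by apply/eqP; rewrite eq_sym subr_eq -innerDl subrK. Qed.

Lemma innerBr X Y Z : inner g Z (X - Y) = inner g Z X - inner g Z Y.
Proof. by rewrite !(innerC Z) innerBl. Qed.

End riemannian.

(** * The horizontal projection of vector fields *)

Section projection.
Variables (R : realType) (n : nat) (M : manifold R n) (S : src_structure M).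
Variable g : riemannian_metric M.
Implicit Types (A Z U V : vfield M).

(** A horizontal field is determined by its horizontal inner products: test
    the difference of the two fields against itself. *)
Lemma horizontal_ext U V : horizontal S U -> horizontal S V ->
  (forall Z, horizontal S Z -> inner g U Z = inner g V Z) -> U = V.
Proof.
move=> hU hV UV; apply/eqP; rewrite -subr_eq0; apply/eqP/vfieldP => p.
have hW := sectionB (horiz_subbundle S) hU hV.
rewrite value0; apply: (metric_eq0 (g := g)).
by rewrite -innerE innerBl UV // subrr.
Qed.

Hypothesis gext : extends_orthogonally S g.

(** The pointwise horizontal part of [A] exists by the direct sum; the point is
    its smoothness. Near p take a frame E of HM with Gram matrix G. Since
    HM is orthogonal to VM, the coordinates a of the horizontal part satisfy
    a G = (<A,E_j>)_j =: r, so (det G) a = r (adj G), where det G, r and adj G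
    have entries in the ring of global smooth functions and det G does not
    vanish wherever E is a basis. *)
Lemma proj_H_exists A : exists B, horizontal S B /\ vertical S (A - B).
Proof.
have [h hP] : exists h : forall p : M, tangent p,
    forall p, horiz S (h p) /\ vert S (value A p - h p).
  have ex (p : M) : exists d, horiz S d /\ vert S (value A p - d).
    by have [/(_ (value A p))[d ? ?] _] := horiz_vert S p; exists d.
  by exists (fun p => sval (cid (ex p))) => p; exact: (svalP (cid (ex p))).
have sh f : smooth (fun p => h p f).
  apply: smooth_quotient => p; have [k [E Eb]] := horiz_subbundle S p.
  pose G : 'M[cinf M]_k := \matrix_(i, j) inner g (E i) (E j).
  pose r : 'rV[cinf M]_k := \row_j inner g A (E j).
  exists (\sum_i (r *m \adj G) 0 i * (E i f : cinf M)), (\det G).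
  apply: filterS Eb => q [free span].
  have Eh i : horiz S (value (E i) q).
    rewrite span; exists (fun j => (j == i)%:R).
    rewrite (bigD1 i) //= eqxx scale1r big1 ?addr0 // => j /negbTE ->.
    by rewrite scale0r.
  pose Gq := map_mx (cinf_eval q) G.
  have GE i j : Gq i j = g q (value (E i) q) (value (E j) q).
    by rewrite !mxE /cinf_eval innerE.
  have combG (a : 'I_k -> R) j : ((\row_i a i) *m Gq) 0 j =
      g q (\sum_i a i *: value (E i) q) (value (E j) q).
    by rewrite metric_suml mxE; apply: eq_bigr => i _; rewrite GE mxE.
  have dE : (\det G : cinf M) q = \det Gq by rewrite det_map_mx.
  have [a ha] : exists a : 'I_k -> R, h q = \sum_i a i *: value (E i) q.
    by have := (hP q).1; rewrite span.
  have aG : (\row_i a i) *m Gq = map_mx (cinf_eval q) r.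
    apply/rowP => j; rewrite combG -ha !mxE /cinf_eval innerE.
    rewrite -[in RHS](subrK (h q) (value A q)) metricDl [X in _ = X + _]metricC.
    by rewrite (gext.2 _ _ _ (Eh j) (hP q).2) add0r.
  have cramer : \det Gq *: \row_i a i = map_mx (cinf_eval q) (r *m \adj G).
    by rewrite map_mxM map_mx_adj -aG -mulmxA mul_mx_adj mul_mx_scalar.
  split.
    (* If v G = 0 then the combination of the frame with coefficients v is
       orthogonal to the frame, hence to itself, hence zero. *)
    rewrite dE; apply/negP => /det0P[v /negP v0 vG]; apply: v0.
    have vE : \row_i v 0 i = v by apply/rowP => i; rewrite mxE.
    apply/eqP/rowP => i; rewrite mxE.
    apply: (free (fun i => v 0 i)); apply: (metric_eq0 (g := g)).
    rewrite metric_suml big1 // => j _.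
    by rewrite metricC -combG vE vG mxE mulr0.
  rewrite dE ha tangent_sumE mulr_sumr -[RHS]/(cinf_eval q _) rmorph_sum.
  apply: eq_bigr => i _; rewrite rmorphM mulrA; congr (_ * _).
  by have /rowP/(_ i) := cramer; rewrite !mxE.
have [B BE] := vfield_of_values sh.
by exists B; split=> p; rewrite ?valueB BE; have [] := hP p.
Qed.

Lemma proj_HP A : horizontal S (proj_H S A) /\ vertical S (A - proj_H S A).
Proof. exact: (xgetPex 0 (proj_H_exists A)). Qed.

Lemma inner_vertical_horizontal V Z :
  vertical S V -> horizontal S Z -> inner g V Z = 0.
Proof. by move=> vV hZ; apply: cinfP => p; rewrite innerC innerE gext.2. Qed.

Lemma inner_horizontal U V : horizontal S U -> horizontal S V ->
  inner (horiz_metric S) U V = inner g U V.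
Proof.
by move=> hU hV; apply: cinfP => p; rewrite innerE inner_section ?gext.1.
Qed.

Lemma inner_proj_H A Z : horizontal S Z -> inner g (proj_H S A) Z = inner g A Z.
Proof.
move=> hZ; have [_ vA] := proj_HP A; apply/eqP.
by rewrite eq_sym -subr_eq0 -innerBl inner_vertical_horizontal.
Qed.

End projection.

(** * The Lie derivative of a connection *)

Section lie_derivative.
Variables (R : realType) (n : nat) (M : manifold R n) (nab : connection M).
Implicit Types (X Y A B K : vfield M).

Lemma nablaBr A X Y : nab A (X - Y) = nab A X - nab A Y.
Proof. by apply/eqP; rewrite eq_sym subr_eq -connection_add subrK. Qed.

Lemma nablaBl A B X : nab (A - B) X = nab A X - nab B X.
Proof.
apply/eqP; rewrite eq_sym subr_eq -[nab (A - B) X]scale1r -connection_linear.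
by rewrite scale1r subrK.
Qed.

Lemma nablaNl A X : nab (- A) X = - nab A X.
Proof. by rewrite -[- A]sub0r nablaBl -{1}(subrr A) nablaBl subrr sub0r. Qed.

Definition lie_nabla K X Y : vfield M :=
  bracket K (nab X Y) - nab (bracket K X) Y - nab X (bracket K Y).

Definition lie_torsion K X Y : vfield M :=
  bracket K (torsion nab X Y) - torsion nab (bracket K X) Y
  - torsion nab X (bracket K Y).

(** The torsion is the antisymmetrization of the connection minus the bracket,
    and the bracket is preserved by [bracket K] (Jacobi). *)
Lemma lie_nabla_antisym K X Y :
  lie_nabla K X Y - lie_nabla K Y X = lie_torsion K X Y.
Proof.
rewrite /lie_nabla /lie_torsion /torsion !bracketBr jacobi.
by apply: vfield_ext => f p; rewrite !(vfield_evalD, vfield_evalN); ring.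
Qed.

End lie_derivative.

(** * Weak H-Killing fields and the canonical connection *)

Section killing.
Variables (R : realType) (n : nat) (M : manifold R n) (S : src_structure M).
Variables (g : riemannian_metric M) (nab : connection M) (K : vfield M).
Hypothesis gext : extends_orthogonally S g.
Hypothesis can : is_canonical_connection S g nab.
Implicit Types (A U V X Y Z : vfield M).

Lemma horizontalB U V : horizontal S U -> horizontal S V -> horizontal S (U - V).
Proof. exact: sectionB (horiz_subbundle S) _ _. Qed.

Lemma nabla_horizontal A U : horizontal S U -> horizontal S (nab A U).
Proof. exact: (canonical_horizontal can). Qed.

Lemma calB_horizontal A : horizontal S (calB S nab K A).
Proof.
apply: (sectionD (horiz_subbundle S)).
  by apply: nabla_horizontal; have [] := proj_HP gext K.
by have [] := proj_HP gext (torsion nab K A).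
Qed.

(** The two descriptions of B_K agree: as the connection preserves VM, the
    horizontal part of nabla_A K is nabla_A K_H, and
    nabla_A K + Tor(K,A) = nabla_K A - [K,A]. *)
Lemma calB_formE A Z : horizontal S Z ->
  calB_form S g nab K A Z = inner g (nab K A - bracket K A) Z.
Proof.
move=> hZ; rewrite /calB_form /calB innerDl (inner_proj_H gext) //.
have [_ vK] := proj_HP gext K.
have := inner_vertical_horizontal gext (canonical_vertical can A vK) hZ.
rewrite nablaBr innerBl => /eqP; rewrite subr_eq0 => /eqP <-.
rewrite -innerDl /torsion; congr (inner g _ Z).
by apply: vfield_ext => f p; rewrite !(vfield_evalD, vfield_evalN); ring.
Qed.

Lemma calB_form_vertical V Z : vertical S V -> horizontal S Z ->
  calB_form S g nab K V Z = - inner g (bracket K V) Z.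
Proof.
move=> vV hZ; rewrite calB_formE // innerBl.
have vKV := canonical_vertical can K vV.
by rewrite (inner_vertical_horizontal gext vKV hZ) sub0r.
Qed.

Hypothesis killing : weak_H_killing S K.

Lemma calB_of_horizontal X : horizontal S X ->
  calB S nab K X = nab K X - bracket K X.
Proof.
move=> hX; apply: (horizontal_ext (g := g)) => [||Z hZ].
- exact: calB_horizontal.
- by apply: horizontalB; [exact: nabla_horizontal|exact: killing.1].
exact: calB_formE.
Qed.

(** Both sides expand to nabla_X nabla_K Y - nabla_K nabla_X Y
    + nabla_[K,X] Y: the brackets [K,Y] and [K, nabla_X Y] brought in by B_K
    are cancelled by those in the Lie derivative of the connection. *)
Lemma curvature_lie_nabla X Y : horizontal S Y ->
  curvature nab X K Y = nabla_calB S nab K Y X - lie_nabla nab K X Y.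
Proof.
move=> hY.
rewrite /nabla_calB !calB_of_horizontal //; last exact: nabla_horizontal.
rewrite /curvature /lie_nabla (bracketC X) nablaNl nablaBr.
by apply: vfield_ext => f p; rewrite !(vfield_evalD, vfield_evalN); ring.
Qed.

(** Apply [K,X] = KX - XK to the function <Y,Z>, using that K differentiates
    inner products of horizontal fields through [bracket K] and that X and
    [K,X] do so through the connection; the terms in which K and X fall on
    different arguments cancel. *)
Lemma lie_nabla_skew X Y Z : horizontal S Y -> horizontal S Z ->
  inner g (lie_nabla nab K X Y) Z + inner g Y (lie_nabla nab K X Z) = 0.
Proof.
move=> hY hZ.
have kill U V : horizontal S U -> horizontal S V -> K (inner g U V) =
    inner g (bracket K U) V + inner g U (bracket K V) :> cinf M.
  move=> hU hV; rewrite -(inner_horizontal gext) // killing.2 //.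
  by rewrite !(inner_horizontal gext) //; exact: killing.1.
have : bracket K X (inner g Y Z) =
    K (X (inner g Y Z)) - X (K (inner g Y Z)) :> cinf M by [].
rewrite kill // (canonical_metric can (bracket K X)) (canonical_metric can X).
rewrite !vfieldD !(canonical_metric can X) !kill //;
  try exact: nabla_horizontal.
rewrite /lie_nabla !innerBl !innerBr => e; apply: cinfP => p.
move: (congr1 (fun h : cinf M => h p) e).
rewrite !(cinfDE, cinfNE, cinf0E); lra.
Qed.

(** Of the three terms of the Lie derivative of the torsion, only
    [K, Tor(X,Y)] has a horizontal part: the other two are torsions of
    horizontal fields. *)
Lemma lie_nabla_torsion X Y Z :
  horizontal S X -> horizontal S Y -> horizontal S Z ->
  inner g (lie_nabla nab K X Y) Z - inner g (lie_nabla nab K Y X) Z =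
  - calB_form S g nab K (torsion nab X Y) Z.
Proof.
move=> hX hY hZ; rewrite -innerBl lie_nabla_antisym /lie_torsion.
have torsion0 U V : horizontal S U -> horizontal S V ->
    inner g (torsion nab U V) Z = 0.
  move=> hU hV; apply: (inner_vertical_horizontal gext) => //.
  exact: (canonical_torsion_H can).
rewrite calB_form_vertical ?opprK //; last exact: (canonical_torsion_H can).
rewrite 2!innerBl [X in _ - X - _]torsion0 ?[X in _ - X]torsion0 ?subr0 //;
  exact: killing.1.
Qed.

End killing.

(** * The curvature formula *)

Theorem lemma5p2 (R : realType) (n : nat) (M : manifold R n)
    (S : src_structure M) (g : riemannian_metric M)
    (nab : connection M) (K X Y Z : vfield M)
    (g_extends : extends_orthogonally S g)
    (nab_canonical : is_canonical_connection S g nab)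
    (K_killing : weak_H_killing S K)
    (X_horizontal : horizontal S X)
    (Y_horizontal : horizontal S Y)
    (Z_horizontal : horizontal S Z) :
  (forall p : M,
    Rm g nab X K Y Z p =
      inner g (nabla_calB S nab K Y X) Z p
      + 2^-1 * calB_form S g nab K (torsion nab X Y) Z p
      - 2^-1 * calB_form S g nab K (torsion nab X Z) Y p
      - 2^-1 * calB_form S g nab K (torsion nab Y Z) X p) /\
  (H_killing S K -> curvature nab X K Y = nabla_calB S nab K Y X).
Proof.
(* The third field is kept free: for the second claim it is a test field. *)
have RmE W : horizontal S W -> forall p, Rm g nab X K Y W p =
      inner g (nabla_calB S nab K Y X) W p
      + 2^-1 * calB_form S g nab K (torsion nab X Y) W p
      - 2^-1 * calB_form S g nab K (torsion nab X W) Y p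
      - 2^-1 * calB_form S g nab K (torsion nab Y W) X p.
  move=> hW p; rewrite /Rm (curvature_lie_nabla g_extends nab_canonical) //.
  rewrite innerBl.
  have skew A B C hB hC := congr1 (cinf_eval p)
    (@lie_nabla_skew _ _ _ _ _ _ _ g_extends nab_canonical K_killing
      A B C hB hC).
  have tors A B C hA hB hC := congr1 (cinf_eval p)
    (@lie_nabla_torsion _ _ _ _ _ _ _ g_extends nab_canonical K_killing
      A B C hA hB hC).
  (* With s A B C := <S(A,B),C> skew in B, C, and t A B C := s A B C - s B A C,
     one has 2 s X Y W = t X Y W - t X W Y - t Y W X. *)
  move: (skew X Y W Y_horizontal hW) (skew Y X W X_horizontal hW)
    (skew W X Y X_horizontal Y_horizontal)
    (tors X Y W X_horizontal Y_horizontal hW)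
    (tors X W Y X_horizontal hW Y_horizontal)
    (tors Y W X Y_horizontal hW X_horizontal).
  rewrite /cinf_eval !(cinfDE, cinfNE, cinf0E).
  rewrite ![inner g _ (lie_nabla nab K _ _)]innerC; lra.
split=> [|[_ K_vertical]]; first exact: RmE.
have calB_torsion0 U V W : horizontal S U -> horizontal S V ->
    horizontal S W -> calB_form S g nab K (torsion nab U V) W = 0.
  move=> hU hV hW; have vT := canonical_torsion_H nab_canonical hU hV.
  rewrite (calB_form_vertical _ g_extends nab_canonical) //.
  by rewrite (inner_vertical_horizontal g_extends (K_vertical _ vT) hW) oppr0.
have hnab A U : horizontal S U -> horizontal S (nab A U).
  exact: (nabla_horizontal nab_canonical).
have hB A := calB_horizontal K g_extends nab_canonical A.
apply: (horizontal_ext (g := g)).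
- apply: horizontalB; last exact: hnab.
  by apply: horizontalB; apply: (hnab); exact: hnab.
- by apply: horizontalB => //; exact: hnab.
move=> W hW; apply: cinfP => p; rewrite -[LHS]/(Rm g nab X K Y W p) RmE //.
by rewrite !calB_torsion0 // !mulr0 !subr0 addr0.
Qed.
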